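(* Let $d$ be a positive integer. There is an algorithm that, given a $(d+1)$-claw free graph $G=(V,E)$, a budget function $b:V\to\mathbb{Z}^+$ and a positive integer $B$, runs in $O(|V|\log|V|+|E|)$ time and is a $d$-factor approximation algorithm for MBIS, i.e., it returns a $B$-budgeted independent set $A$ with $|A^*|\le d|A|$ for every maximum-cardinality $B$-budgeted independent set $A^*$ of $G$.
   Context: A graph is $(d+1)$-claw free if it contains no induced subgraph isomorphic to $K_{1,d+1}$. The budget of $S\subseteq V$ is $\sum_{v\in S}b(v)$; a $B$-budgeted independent set is an independent set with budget at most $B$. MBIS (Maximum Budgeted Independent Set) is the problem of finding a $B$-budgeted independent set of maximum cardinality. The graph is given by adjacency lists. *)

(* Defs.v *)
From mathcomp Require Import all_boot.

Set Implicit Arguments.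
Unset Strict Implicit.
Unset Printing Implicit Defensive.

Section Graph.
Variables (T : finType) (e : rel T).

Definition edges : {set {set T}} :=
  [set A : {set T} | [exists x, exists y, e x y && (A == [set x; y])]].

Definition independent (S : {set T}) : Prop := {in S &, forall x y, ~~ e x y}.

Definition induced_subgraph (U : finType) (h : rel U) : Prop :=
  exists f : U -> T, injective f /\ forall x y, e (f x) (f y) = h x y.

Variables (b : T -> nat) (B : nat).

Definition budget (S : {set T}) : nat := \sum_(v in S) b v.

Definition budgeted_independent (S : {set T}) : Prop :=
  independent S /\ budget S <= B.

Definition max_budgeted_independent (S : {set T}) : Prop :=
  budgeted_independent S /\
  forall S' : {set T}, budgeted_independent S' -> #|S'| <= #|S|.

End Graph.

(* K_{1,k}: the centre is None, the leaves are the Some i. *)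
Definition star (k : nat) : rel (option 'I_k) := fun x y => isSome x != isSome y.

Definition claw_free (k : nat) (T : finType) (e : rel T) : Prop :=
  ~ induced_subgraph e (@star k).

(* Structured RAM programs: natural-number registers, an unbounded memory of
   natural numbers with indirect addressing, and as only arithmetic addition
   and truncated subtraction.  Instructions are in three-address form, so that
   each assignment and each evaluation of a test is a single RAM step up to a
   constant factor. *)

Inductive operand := Cst of nat | Reg of nat.

Inductive test := TestLt of operand & operand | TestEq of operand & operand.

Inductive cmd :=
  | Skip
  | Move of nat & operand
  | Add of nat & operand & operand
  | Sub of nat & operand & operand
  | Read of nat & operand
  | Write of operand & operand
  | Seq of cmd & cmd
  | If of test & cmd & cmd
  | While of test & cmd.

Record state := State { reg : nat -> nat; cell : nat -> nat }.

Definition update (f : nat -> nat) (i v : nat) : nat -> nat :=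
  fun j => if j == i then v else f j.

Definition set_reg (s : state) (r v : nat) : state :=
  State (update (reg s) r v) (cell s).

Definition set_mem (s : state) (a v : nat) : state :=
  State (reg s) (update (cell s) a v).

Definition eval (s : state) (o : operand) : nat :=
  match o with Cst k => k | Reg r => reg s r end.

Definition holds (s : state) (t : test) : bool :=
  match t with
  | TestLt x y => eval s x < eval s y
  | TestEq x y => eval s x == eval s y
  end.

Inductive exec : cmd -> state -> nat -> state -> Prop :=
  | ExecSkip s : exec Skip s 1 s
  | ExecMove s r x : exec (Move r x) s 1 (set_reg s r (eval s x))
  | ExecAdd s r x y : exec (Add r x y) s 1 (set_reg s r (eval s x + eval s y))
  | ExecSub s r x y : exec (Sub r x y) s 1 (set_reg s r (eval s x - eval s y))
  | ExecRead s r x : exec (Read r x) s 1 (set_reg s r (cell s (eval s x)))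
  | ExecWrite s x y : exec (Write x y) s 1 (set_mem s (eval s x) (eval s y))
  | ExecSeq p q s t s' t' s'' :
      exec p s t s' -> exec q s' t' s'' -> exec (Seq p q) s (t + t') s''
  | ExecIfTrue c p q s t s' :
      holds s c -> exec p s t s' -> exec (If c p q) s t.+1 s'
  | ExecIfFalse c p q s t s' :
      ~~ holds s c -> exec q s t s' -> exec (If c p q) s t.+1 s'
  | ExecWhileTrue c p s t s' t' s'' :
      holds s c -> exec p s t s' -> exec (While c p) s' t' s'' ->
      exec (While c p) s (t + t').+1 s''
  | ExecWhileFalse c p s : ~~ holds s c -> exec (While c p) s 1 s.

Lemma exec_det p s t1 s1 t2 s2 :
  exec p s t1 s1 -> exec p s t2 s2 -> t1 = t2 /\ s1 = s2.
Proof.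
move=> H; elim: H t2 s2 => {p s t1 s1}.
- by move=> s t2 s2 H; inversion H; subst.
- by move=> s r x t2 s2 H; inversion H; subst.
- by move=> s r x y t2 s2 H; inversion H; subst.
- by move=> s r x y t2 s2 H; inversion H; subst.
- by move=> s r x t2 s2 H; inversion H; subst.
- by move=> s x y t2 s2 H; inversion H; subst.
- move=> p q s t s' t' s'' _ IHp _ IHq t2 s2 H; inversion H; subst.
  match goal with K : exec p _ _ _ |- _ => have [? ?] := IHp _ _ K end; subst.
  by match goal with K : exec q _ _ _ |- _ => have [-> ->] := IHq _ _ K end.
- move=> c p q s t s' hc _ IH t2 s2 H; inversion H; subst; last first.
    by move: hc; match goal with K : is_true (~~ _) |- _ => rewrite (negbTE K) end.
  by match goal with K : exec p _ _ _ |- _ => have [-> ->] := IH _ _ K end.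
- move=> c p q s t s' hc _ IH t2 s2 H; inversion H; subst.
    by case/negP: hc.
  by match goal with K : exec q _ _ _ |- _ => have [-> ->] := IH _ _ K end.
- move=> c p s t s' t' s'' hc _ IHp _ IHw t2 s2 H; inversion H; subst; last first.
    by move: hc; match goal with K : is_true (~~ _) |- _ => rewrite (negbTE K) end.
  match goal with K : exec p _ _ _ |- _ => have [? ?] := IHp _ _ K end; subst.
  by match goal with K : exec (While c p) _ _ s2 |- _ =>
    have [-> ->] := IHw _ _ K end.
- move=> c p s hc t2 s2 H; inversion H; subst => //.
  by case/negP: hc.
Qed.

Definition init (input : seq nat) : state := State (fun=> 0) (nth 0 input).

(* The result is an array in memory: register 0 holds its address and
   register 1 its length. *)
Definition output (s : state) : seq nat :=
  [seq cell s (reg s 0 + i) | i <- iota 0 (reg s 1)].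

Section Encoding.
Variable T : finType.

(* Vertices are numbered 0, ..., |V| - 1 along enum T. *)
Definition vertex_num (v : T) : nat := enum_rank v.

(* The order of the neighbours within each list is arbitrary. *)
Definition adjacency_lists (e : rel T) (adj : T -> seq T) : Prop :=
  forall v, uniq (adj v) /\ forall w, (w \in adj v) = e v w.

(* The sequence |V|, B, b(0), ..., b(|V| - 1), followed for each vertex by its
   degree and its list of neighbours. *)
Definition encode (adj : T -> seq T) (b : T -> nat) (B : nat) : seq nat :=
  [:: #|T|, B & [seq b v | v <- enum T]] ++
  flatten [seq size (adj v) :: [seq vertex_num w | w <- adj v] | v <- enum T].

End Encoding.

(* Main.v *)
(** The algorithm repeatedly extracts a cheapest remaining vertex and selects it
    unless it is adjacent to a selected vertex; it stops when the budget would be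
    exceeded.  The extraction uses a tournament tree: node [i < n] holds the
    minimum of nodes [2 i] and [2 i + 1], the vertices are the leaves
    [n, ..., 2 n - 1], and an extracted leaf gets the key [B + 1].  Changing the
    key of a leaf leaves a single incorrect node, its parent, so repairing the
    path to the root takes [O(log n)] steps.

    Let [A] be the selected set and [M] the least remaining key at the end.  In an
    independent set [A'], every extracted vertex is charged to an equal or
    adjacent vertex of [A] that is not more expensive; by claw-freeness each
    vertex of [A] is charged at most [d] times.  The other vertices of [A'] cost
    at least [M].  If [A'] had more than [d * #|A|] elements, it would thus cost
    at least [d * budget A + M > B]. *)

Require Import Defs.
From mathcomp Require Import all_boot.
From mathcomp Require Import zify.

Set Implicit Arguments.
Unset Strict Implicit.
Unset Printing Implicit Defensive.

(** * Weakest preconditions with running time *)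

Definition value (rs : seq nat) (o : operand) : nat :=
  match o with Cst k => k | Reg r => nth 0 rs r end.

Definition passes (rs : seq nat) (c : test) : bool :=
  match c with
  | TestLt x y => value rs x < value rs y
  | TestEq x y => value rs x == value rs y
  end.

(* The argument [t] of the assertions is the time spent so far.  As every iteration
   takes time, the bound [N] on [t] in a loop invariant forces termination. *)
Fixpoint wp (p : cmd) (Q : nat -> seq nat -> (nat -> nat) -> Prop)
    (t : nat) (rs : seq nat) (m : nat -> nat) : Prop :=
  match p with
  | Skip => Q t.+1 rs m
  | Move r x => Q t.+1 (set_nth 0 rs r (value rs x)) m
  | Add r x y => Q t.+1 (set_nth 0 rs r (value rs x + value rs y)) m
  | Defs.Sub r x y => Q t.+1 (set_nth 0 rs r (value rs x - value rs y)) m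
  | Read r x => Q t.+1 (set_nth 0 rs r (m (value rs x))) m
  | Write x y => Q t.+1 rs (update m (value rs x) (value rs y))
  | Seq p q => wp p (wp q Q) t rs m
  | If c p q =>
      if passes rs c then wp p Q t.+1 rs m else wp q Q t.+1 rs m
  | While c p => exists I N, I t rs m /\
      forall t rs m, I t rs m -> t <= N /\
        if passes rs c then wp p I t.+1 rs m else Q t.+1 rs m
  end.

(** Machine registers and memory are functions. Registers are mirrored by a finite list, with
    default [0] beyond its end, so that [simpl] can compute register updates; pointwise equality
    avoids functional extensionality. *)
Definition represents (s : state) (rs : seq nat) (m : nat -> nat) : Prop :=
  reg s =1 nth 0 rs /\ cell s =1 m.

Lemma eval_represents s rs m o : represents s rs m -> eval s o = value rs o.
Proof. by case=> sr _; case: o => //= r; rewrite sr. Qed.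

Lemma holds_represents s rs m c : represents s rs m -> holds s c = passes rs c.
Proof. by move=> sR; case: c => x y /=; rewrite !(eval_represents _ sR). Qed.

Lemma represents_set_reg s rs m r v :
  represents s rs m -> represents (set_reg s r v) (set_nth 0 rs r v) m.
Proof. by case=> sr sm; split=> // i; rewrite nth_set_nth /= /update sr. Qed.

Lemma represents_set_mem s rs m a v :
  represents s rs m -> represents (set_mem s a v) rs (update m a v).
Proof. by case=> sr sm; split=> // i; rewrite /= /update sm. Qed.

(** The execution is constructed, so termination is part of the conclusion. Induction on the
    program, with an inner induction for loops. *)
Lemma wp_sound p Q t rs m s : wp p Q t rs m -> represents s rs m ->
  exists dt s' rs' m',
    [/\ exec p s dt s', represents s' rs' m' & Q (t + dt) rs' m'].
Proof.
elim: p Q t rs m s => /= [|r x|r x y|r x y|r x|x y|p IHp q IHq|c p IHp q IHq|c p IHp]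
  Q t rs m s H sR.
- by exists 1, s, rs, m; rewrite addn1; split=> //; constructor.
- exists 1; do 3! eexists; rewrite addn1; split; [by constructor| |exact: H].
  by rewrite (eval_represents _ sR); exact: represents_set_reg.
- exists 1; do 3! eexists; rewrite addn1; split; [by constructor| |exact: H].
  by rewrite !(eval_represents _ sR); exact: represents_set_reg.
- exists 1; do 3! eexists; rewrite addn1; split; [by constructor| |exact: H].
  by rewrite !(eval_represents _ sR); exact: represents_set_reg.
- exists 1; do 3! eexists; rewrite addn1; split; [by constructor| |exact: H].
  rewrite (eval_represents _ sR) (proj2 sR).
  exact: represents_set_reg.
- exists 1; do 3! eexists; rewrite addn1; split; [by constructor| |exact: H].
  by rewrite !(eval_represents _ sR); exact: represents_set_mem.
- have [t1 [s1 [rs1 [m1 [e1 R1 H1]]]]] := IHp _ _ _ _ _ H sR.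
  have [t2 [s2 [rs2 [m2 [e2 R2 H2]]]]] := IHq _ _ _ _ _ H1 R1.
  exists (t1 + t2), s2, rs2, m2; rewrite addnA; split=> //; exact: ExecSeq e1 e2.
- move: H; rewrite -(holds_represents _ sR); case: ifPn => hc H.
    have [t1 [s1 [rs1 [m1 [e1 R1 H1]]]]] := IHp _ _ _ _ _ H sR.
    by exists t1.+1, s1, rs1, m1; rewrite -addSnnS; split=> //; exact: ExecIfTrue.
  have [t1 [s1 [rs1 [m1 [e1 R1 H1]]]]] := IHq _ _ _ _ _ H sR.
  by exists t1.+1, s1, rs1, m1; rewrite -addSnnS; split=> //; exact: ExecIfFalse.
case: H => I [N [It Istep]].
(* Evaluating the test already costs one step, so [N.+1 - t] decreases strictly at each iteration
   while the invariant keeps [t <= N]. *)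
have [k lek] := ubnP (N.+1 - t).
elim: k t rs m s lek It sR => // k IHk t rs m s lek It sR.
have [leN] := Istep _ _ _ It.
rewrite -(holds_represents _ sR); case: ifPn => hc H; last first.
  by exists 1, s, rs, m; rewrite addn1; split=> //; exact: ExecWhileFalse.
have [t1 [s1 [rs1 [m1 [e1 R1 H1]]]]] := IHp _ _ _ _ _ H sR.
have lek1 : N.+1 - (t.+1 + t1) < k by lia.
have [t2 [s2 [rs2 [m2 [e2 R2 H2]]]]] := IHk _ _ _ _ lek1 H1 R1.
exists (t1 + t2).+1, s2, rs2, m2; split=> //; first exact: ExecWhileTrue hc e1 e2.
by rewrite addnS addnA -addSn -addSn.
Qed.

(** * The program *)

Local Infix ";;" := Seq (at level 60, right associativity).

(* Registers: 0 result address, 1 result length, 2 [n], 3 [B + 1], 4 tree, 5 table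
   of halved indices, 6 addresses of the adjacency lists, 7 blocked flags,
   8 budget spent, 9 least remaining key, 10 to 15 scratch. *)
Definition skip_lists : cmd :=
  Move 11 (Cst 0) ;; Add 10 (Reg 2) (Cst 2) ;;
  While (TestLt (Reg 11) (Reg 2))
    (Read 12 (Reg 10) ;; Add 10 (Reg 10) (Reg 12) ;; Add 10 (Reg 10) (Cst 1) ;;
     Add 11 (Reg 11) (Cst 1)).

Definition allocate : cmd :=
  Move 4 (Reg 10) ;;
  Add 5 (Reg 4) (Reg 2) ;; Add 5 (Reg 5) (Reg 2) ;;
  Add 6 (Reg 5) (Reg 2) ;; Add 6 (Reg 6) (Reg 2) ;;
  Add 7 (Reg 6) (Reg 2) ;; Add 0 (Reg 7) (Reg 2).

(** A second scan of the lists: their addresses can be stored only once the first scan has found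
    where the input ends and free memory begins. *)
Definition fill_leaves : cmd :=
  Move 11 (Cst 0) ;; Add 10 (Reg 2) (Cst 2) ;;
  While (TestLt (Reg 11) (Reg 2))
    (Add 12 (Reg 6) (Reg 11) ;; Write (Reg 12) (Reg 10) ;;
     Add 12 (Reg 11) (Cst 2) ;; Read 12 (Reg 12) ;;
     Add 13 (Reg 2) (Reg 11) ;; Add 13 (Reg 4) (Reg 13) ;;
     Write (Reg 13) (Reg 12) ;;
     Read 12 (Reg 10) ;; Add 10 (Reg 10) (Reg 12) ;; Add 10 (Reg 10) (Cst 1) ;;
     Add 11 (Reg 11) (Cst 1)).

Definition pull : cmd :=
  Add 12 (Reg 11) (Reg 11) ;; Add 13 (Reg 4) (Reg 12) ;; Read 13 (Reg 13) ;;
  Add 12 (Reg 12) (Cst 1) ;; Add 14 (Reg 4) (Reg 12) ;; Read 14 (Reg 14) ;;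
  Add 12 (Reg 4) (Reg 11) ;;
  If (TestLt (Reg 13) (Reg 14)) (Write (Reg 12) (Reg 13)) (Write (Reg 12) (Reg 14)).

(** Division is not an instruction, so the parent of each node is tabulated here: node [i] is
    recorded at [2 i] and [2 i + 1]. *)
Definition build_tree : cmd :=
  Defs.Sub 11 (Reg 2) (Cst 1) ;;
  While (TestLt (Cst 0) (Reg 11))
    (Add 12 (Reg 11) (Reg 11) ;; Add 13 (Reg 5) (Reg 12) ;;
     Write (Reg 13) (Reg 11) ;;
     Add 12 (Reg 12) (Cst 1) ;; Add 13 (Reg 5) (Reg 12) ;;
     Write (Reg 13) (Reg 11) ;;
     pull ;; Defs.Sub 11 (Reg 11) (Cst 1)).

Definition descend : cmd :=
  Move 11 (Cst 1) ;;
  While (TestLt (Reg 11) (Reg 2))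
    (Add 12 (Reg 11) (Reg 11) ;; Add 13 (Reg 4) (Reg 12) ;; Read 13 (Reg 13) ;;
     If (TestEq (Reg 13) (Reg 9)) (Move 11 (Reg 12)) (Add 11 (Reg 12) (Cst 1))).

Definition ascend : cmd :=
  While (TestLt (Cst 1) (Reg 11))
    (Add 12 (Reg 5) (Reg 11) ;; Read 11 (Reg 12) ;; pull).

Definition block_neighbours : cmd :=
  Add 12 (Reg 6) (Reg 15) ;; Read 12 (Reg 12) ;;
  Read 13 (Reg 12) ;; Add 13 (Reg 12) (Reg 13) ;;
  While (TestLt (Reg 12) (Reg 13))
    (Add 12 (Reg 12) (Cst 1) ;; Read 14 (Reg 12) ;; Add 14 (Reg 7) (Reg 14) ;;
     Write (Reg 14) (Cst 1)).

Definition next_cost : cmd :=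
  Add 12 (Reg 4) (Cst 1) ;; Read 9 (Reg 12) ;; Add 13 (Reg 8) (Reg 9).

Definition select : cmd :=
  Add 8 (Reg 8) (Reg 9) ;; Add 12 (Reg 0) (Reg 1) ;; Write (Reg 12) (Reg 15) ;;
  Add 1 (Reg 1) (Cst 1) ;; block_neighbours.

(** Once every leaf has been extracted the root holds [B + 1] and the test fails, so no counter of
    remaining vertices is kept. *)
Definition greedy : cmd :=
  next_cost ;;
  While (TestLt (Reg 13) (Reg 3))
    (descend ;; Defs.Sub 15 (Reg 11) (Reg 2) ;;
     Add 12 (Reg 4) (Reg 11) ;; Write (Reg 12) (Reg 3) ;; ascend ;;
     Add 12 (Reg 7) (Reg 15) ;; Read 12 (Reg 12) ;;
     If (TestEq (Reg 12) (Cst 0)) select Skip ;;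
     next_cost).

Definition mbis_program : cmd :=
  Read 2 (Cst 0) ;;
  If (TestLt (Cst 0) (Reg 2))
    (Read 3 (Cst 1) ;; Add 3 (Reg 3) (Cst 1) ;;
     skip_lists ;; allocate ;; fill_leaves ;; build_tree ;; greedy)
    Skip.

#[local] Arguments update : simpl never.

(** * Correctness of the loops *)

(** Here [pos v] stands for the address of the [v]-th list. The time is two assignments, five steps
    per iteration including the test, and the final failing test. *)
Lemma wp_skip_lists (n B1 : nat) (m pos : nat -> nat) Q t u10 u11 u12 u13 u14 u15 :
  pos 0 = n + 2 -> (forall v, v < n -> pos v.+1 = pos v + m (pos v) + 1) ->
  (forall u11 u12, Q (t + 5 * n + 3)
     [:: 0; 0; n; B1; 0; 0; 0; 0; 0; 0; pos n; u11; u12; u13; u14; u15] m) ->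
  wp skip_lists Q t [:: 0; 0; n; B1; 0; 0; 0; 0; 0; 0; u10; u11; u12; u13; u14; u15] m.
Proof.
move=> pos0 posS H; rewrite /skip_lists /=.
exists (fun t' rs m' => exists v u12,
  [/\ m' = m, v <= n, t' = t + 5 * v + 2 &
     rs = [:: 0; 0; n; B1; 0; 0; 0; 0; 0; 0; pos v; v; u12; u13; u14; u15]]).
exists (t + 5 * n + 2); split; first by exists 0, u12; split=> //; [lia|rewrite pos0].
move=> t' rs m' [v [v12 [-> len -> ->]]]; split; first by lia.
rewrite /=; case: ifPn => lt.
  exists v.+1, (m (pos v)); split=> //; first by lia.
  by rewrite posS // !addn1.
have -> : v = n by lia.
have -> : (t + 5 * n + 2).+1 = t + 5 * n + 3 by lia.
exact: H.
Qed.

(** * Tournament trees stored as arrays *)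

Section Tree.
Variable n : nat.

Definition node_ok (tree : nat -> nat) (i : nat) : Prop :=
  tree i = minn (tree (i + i)) (tree (i + i + 1)).

Definition tree_ok (tree : nat -> nat) : Prop :=
  forall i, 0 < i < n -> node_ok tree i.

(** Strong induction through the parent [i./2], whose key is at most that of [i]. *)
Lemma tree_root_min tree i :
  tree_ok tree -> 0 < i < n + n -> tree 1 <= tree i.
Proof.
move=> ok; have [k] := ubnP i; elim: k i => // k IH i ltik lti.
case: (ltnP 1 i) => [i_gt1|]; last by case: i lti {ltik} => [|[|]].
apply: (@leq_trans (tree i./2)); first by apply: IH; lia.
rewrite ok; last by lia.
have : i = i./2 + i./2 \/ i = i./2 + i./2 + 1 by lia.
by move: i./2 => h [->|->]; rewrite geq_min leqnn ?orbT.
Qed.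

(** Follow the smaller child. Both children of a node below [n] have a larger index, still below
    [2 n], so a leaf is reached even if [n] is not a power of two. *)
Lemma tree_root_attained tree :
  0 < n -> tree_ok tree -> exists2 k, k < n & tree (n + k) = tree 1.
Proof.
move=> n_gt0 ok; suff attained i : 0 < i < n + n ->
    exists2 k, k < n & tree (n + k) = tree i by apply: attained; lia.
have [k] := ubnP (n + n - i); elim: k i => // k IH i ltk lti.
case: (leqP n i) => [lein|ltin].
  by exists (i - n); [lia | rewrite subnKC].
rewrite ok; last by lia.
by rewrite /minn; case: ifP => _; apply: IH; lia.
Qed.

End Tree.

(** * Memory layout and the loops that work on the tables *)

Section Loops.
Variables (n B1 a0 a1 a2 a3 a4 : nat) (inp : nat -> nat).
Hypotheses (n_gt0 : 0 < n) (a1E : a1 = a0 + n + n) (a2E : a2 = a1 + n + n)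
  (a3E : a3 = a2 + n) (a4E : a4 = a3 + n).

(* The memory holds the input, the tree [tree], the table [half] of halved
   indices, the addresses [adr] of the adjacency lists, the flags [blk] and the
   result [out], in this order. *)
Record layout (tree half adr blk out m : nat -> nat) : Prop := Layout {
  layout_input : forall i, i < a0 -> m i = inp i;
  layout_tree : forall i, i < n + n -> m (a0 + i) = tree i;
  layout_half : forall i, i < n + n -> m (a1 + i) = half i;
  layout_adr : forall i, i < n -> m (a2 + i) = adr i;
  layout_blk : forall i, i < n -> m (a3 + i) = blk i;
  layout_out : forall i, i < n -> m (a4 + i) = out i }.

Lemma layout_set_tree tree half adr blk out m i v :
  layout tree half adr blk out m -> i < n + n ->
  layout (update tree i v) half adr blk out (update m (a0 + i) v).
Proof.
case=> h1 h2 h3 h4 h5 h6 lti.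
by split=> k ltk; rewrite /update -?h2 -?h1 -?h3 -?h4 -?h5 -?h6 //;
  do ?case: eqP => //; lia.
Qed.

Lemma layout_set_half tree half adr blk out m i v :
  layout tree half adr blk out m -> i < n + n ->
  layout tree (update half i v) adr blk out (update m (a1 + i) v).
Proof.
case=> h1 h2 h3 h4 h5 h6 lti.
by split=> k ltk; rewrite /update -?h2 -?h1 -?h3 -?h4 -?h5 -?h6 //;
  do ?case: eqP => //; lia.
Qed.

Lemma layout_set_adr tree half adr blk out m i v :
  layout tree half adr blk out m -> i < n ->
  layout tree half (update adr i v) blk out (update m (a2 + i) v).
Proof.
case=> h1 h2 h3 h4 h5 h6 lti.
by split=> k ltk; rewrite /update -?h2 -?h1 -?h3 -?h4 -?h5 -?h6 //;
  do ?case: eqP => //; lia.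
Qed.

Lemma layout_set_blk tree half adr blk out m i v :
  layout tree half adr blk out m -> i < n ->
  layout tree half adr (update blk i v) out (update m (a3 + i) v).
Proof.
case=> h1 h2 h3 h4 h5 h6 lti.
by split=> k ltk; rewrite /update -?h2 -?h1 -?h3 -?h4 -?h5 -?h6 //;
  do ?case: eqP => //; lia.
Qed.

Lemma layout_set_out tree half adr blk out m i v :
  layout tree half adr blk out m -> i < n ->
  layout tree half adr blk (update out i v) (update m (a4 + i) v).
Proof.
case=> h1 h2 h3 h4 h5 h6 lti.
by split=> k ltk; rewrite /update -?h2 -?h1 -?h3 -?h4 -?h5 -?h6 //;
  do ?case: eqP => //; lia.
Qed.

(** The register file after allocation: [c] is the result length, [S] the budget spent, [x] the
    least remaining key, and the [u]s are scratch. *)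
Definition regs c S x u10 u11 u12 u13 u14 u15 : seq nat :=
  [:: a4; c; n; B1; a0; a1; a2; a3; S; x; u10; u11; u12; u13; u14; u15].

Lemma wp_pull Q t tree half adr blk out m c S x u10 i u12 u13 u14 u15 :
  layout tree half adr blk out m -> 0 < i < n ->
  (forall u12 u13 u14, Q (t + 9) (regs c S x u10 i u12 u13 u14 u15)
     (update m (a0 + i) (minn (tree (i + i)) (tree (i + i + 1))))) ->
  wp pull Q t (regs c S x u10 i u12 u13 u14 u15) m.
Proof.
move=> L lti H; rewrite /pull /=.
have e1 : m (a0 + (i + i)) = tree (i + i) by apply: (layout_tree L); lia.
have e2 : m (a0 + (i + i + 1)) = tree (i + i + 1) by apply: (layout_tree L); lia.
rewrite e1 e2; case: ifPn => lt.
  by move: (H (a0 + i) (tree (i + i)) (tree (i + i + 1)));rewrite /minn lt !addnS addn0.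
by move: (H (a0 + i) (tree (i + i)) (tree (i + i + 1))); rewrite /minn (negbTE lt) !addnS addn0.
Qed.

Local Opaque pull.

(** Each iteration takes six steps and at least doubles the index. The invariant [2 ^ j <= i] after
    [j] iterations thus bounds their number by the logarithm. *)
Lemma wp_descend Q t tree half adr blk out m c S u10 u11 u12 u13 u14 u15 :
  layout tree half adr blk out m -> tree_ok n tree ->
  (forall t' i u12 u13, t' <= t + 6 * (trunc_log 2 n).+1 + 2 ->
     n <= i < n + n -> tree i = tree 1 ->
     Q t' (regs c S (tree 1) u10 i u12 u13 u14 u15) m) ->
  wp descend Q t (regs c S (tree 1) u10 u11 u12 u13 u14 u15) m.
Proof.
move=> L ok H; rewrite /descend /=.
exists (fun t' rs m' => exists i j u12 u13,
  [/\ m' = m, rs = regs c S (tree 1) u10 i u12 u13 u14 u15,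
      t' + 6 * ((trunc_log 2 n).+1 - j) <= t + 6 * (trunc_log 2 n).+1 + 1,
      2 ^ j <= i < n + n & tree i = tree 1 /\ j <= (trunc_log 2 n).+1]).
exists (t + 6 * (trunc_log 2 n).+1 + 1); split.
  by exists 1, 0, u12, u13; split=> //=; rewrite ?expn0; lia.
move=> t' rs m' [i [j [v12 [v13 [-> -> le_t /andP[lej lti] [ei lejl]]]]]]; split; first by lia.
have := expn_gt0 2 j; rewrite /= => i_gt0.
case: ifPn => lt; last by apply: H => //; lia.
have jl : j <= trunc_log 2 n by apply: trunc_log_max => //; lia.
have e1 : m (a0 + (i + i)) = tree (i + i) by apply: (layout_tree L); lia.
have oki : node_ok tree i by apply: ok; lia.
rewrite e1; case: ifPn => E.
  exists (i + i), j.+1, (i + i), (tree (i + i)); split=> //; rewrite ?expnS; try lia.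
exists (i + i + 1), j.+1, (i + i), (tree (i + i)); split=> //; rewrite ?expnS; try lia.
(* The left child differs from the minimum, so the right child attains it. *)
by split=> //; move: oki E; rewrite /node_ok; lia.
Qed.

(** The invariant allows one incorrect node, the parent of the current one. The current index stays
    below [2 ^ j] with [j] decreasing; initially [2 n < 2 ^ (trunc_log 2 n).+2]. *)
Lemma wp_ascend Q t tree half adr blk out m c S x u10 p u12 u13 u14 u15 :
  layout tree half adr blk out m ->
  (forall i, 1 < i < n + n -> half i = i./2) ->
  0 < p < n + n -> (forall i, 0 < i < n -> i != p./2 -> node_ok tree i) ->
  (forall t' tree' u11 u12 u13 u14 m',
     t' <= t + 12 * (trunc_log 2 n).+2 + 1 ->
     layout tree' half adr blk out m' -> tree_ok n tree' ->
     (forall i, n <= i -> tree' i = tree i) ->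
     Q t' (regs c S x u10 u11 u12 u13 u14 u15) m') ->
  wp ascend Q t (regs c S x u10 p u12 u13 u14 u15) m.
Proof.
move=> L hE ltp ok H; rewrite /ascend.
exists (fun t' rs m' => exists tree' p j u12 u13 u14,
  [/\ rs = regs c S x u10 p u12 u13 u14 u15, layout tree' half adr blk out m',
      (forall i, n <= i -> tree' i = tree i) /\
      t' + 12 * j <= t + 12 * (trunc_log 2 n).+2,
      0 < p < n + n /\ p < 2 ^ j &
      forall i, 0 < i < n -> i != p./2 -> node_ok tree' i]).
exists (t + 12 * (trunc_log 2 n).+2); split.
  exists tree, p, (trunc_log 2 n).+2, u12, u13, u14; split=> //.
  split=> //; have := @trunc_log_ltn 2 n isT; rewrite (expnS _ (_.+1)); lia.
move=> t' rs m' [tree' [q [j [v12 [v13 [v14 [-> L' [leaves le_t] [ltq lej] ok']]]]]]].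
split; first by lia.
rewrite /=; case: ifPn => lt; last first.
  apply: H L' _ leaves; first by lia.
  (* At exit the current node is the root, so the exception [q./2] is [0], which is not an inner
     node. *)
  by move=> i lti; apply: ok' => //; lia.
have e1 : m' (a1 + q) = q./2 by rewrite (layout_half L') ?hE; lia.
rewrite /= e1; apply: (wp_pull _ _ _ L'); first by lia.
move=> w12 w13 w14.
case: j lej le_t => [|j]; first by rewrite expn0; lia.
rewrite expnS => lej le_t.
exists (update tree' q./2 (minn (tree' (q./2 + q./2)) (tree' (q./2 + q./2 + 1)))).
exists q./2, j, w12, w13, w14; split=> //; try lia.
- by apply: (layout_set_tree _ L'); lia.
- by split; [move=> i lti; rewrite -leaves // /update; case: eqP => //; lia|lia].
move=> i lti ne; rewrite /node_ok /update.
(* Only the parent of [q./2] reads the changed key, and [i] differs from that parent. *)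
have /negPf -> : i + i != q./2 by lia.
have /negPf -> : i + i + 1 != q./2 by lia.
by case: eqP => [->|/eqP ne'] //; apply: ok'.
Qed.

Local Opaque descend ascend.

Lemma wp_fill_leaves Q t tree half adr blk out m pos c S x u10 u11 u12 u13 u14 u15 :
  layout tree half adr blk out m ->
  pos 0 = n + 2 ->
  (forall v, v < n -> pos v < a0 /\ pos v.+1 = pos v + inp (pos v) + 1) ->
  n + 2 <= a0 ->
  (forall tree' adr' u10 u11 u12 u13 m',
     layout tree' half adr' blk out m' ->
     (forall v, v < n -> tree' (n + v) = inp (v + 2) /\ adr' v = pos v) ->
     Q (t + 12 * n + 3) (regs c S x u10 u11 u12 u13 u14 u15) m') ->
  wp fill_leaves Q t (regs c S x u10 u11 u12 u13 u14 u15) m.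
Proof.
move=> L pos0 posS lea0 H; rewrite /fill_leaves /=.
exists (fun t' rs m' => exists v tree' adr' u12 u13,
  [/\ layout tree' half adr' blk out m',
      rs = regs c S x (pos v) v u12 u13 u14 u15,
      v <= n, t' = t + 12 * v + 2 &
      forall w, w < v -> tree' (n + w) = inp (w + 2) /\ adr' w = pos w]).
exists (t + 12 * n + 2); split.
  by exists 0, tree, adr, u12, u13; split=> //; [rewrite pos0|lia].
move=> t' rs m' [v [tree' [adr' [v12 [v13 [L' -> len -> IH]]]]]]; split; first by lia.
rewrite /=; case: ifPn => lt; last first.
  have -> : (t + 12 * v + 2).+1 = t + 12 * n + 3 by lia.
  by apply: H L' _ => w ltw; apply: IH; lia.
have [ltp pS] := posS _ lt.
have L1 := layout_set_adr (pos v) L' lt.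
have e1 := layout_input L1 (_ : v + 2 < a0); rewrite e1; last by lia.
have lt2 : n + v < n + n by lia.
have L2 := layout_set_tree (inp (v + 2)) L1 lt2.
rewrite (layout_input L2 ltp) !addn1 -[(pos v + _).+1]addn1 -pS.
do 5! eexists; split; [exact: L2|reflexivity|by []|lia|].
move=> w; rewrite ltnS leq_eqVlt => /orP[/eqP->|ltw]; first by rewrite /update !eqxx.
rewrite /update ifN ?ifN; first exact: IH; lia.
Qed.

(** Nodes are treated from [n - 1] down to [1], so both children are final when a node is computed,
    and the halved indices from [2] to [2 n - 1] are all written. *)
Lemma wp_build_tree Q t tree half adr blk out m c S x u10 u11 u12 u13 u14 u15 :
  layout tree half adr blk out m ->
  (forall t' tree' half' u11 u12 u13 u14 m', t' <= t + 17 * n + 2 ->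
     layout tree' half' adr blk out m' -> tree_ok n tree' ->
     (forall i, n <= i -> tree' i = tree i) ->
     (forall i, 1 < i < n + n -> half' i = i./2) ->
     Q t' (regs c S x u10 u11 u12 u13 u14 u15) m') ->
  wp build_tree Q t (regs c S x u10 u11 u12 u13 u14 u15) m.
Proof.
move=> L H; rewrite /build_tree /=.
exists (fun t' rs m' => exists i tree' half' u12 u13 u14,
  [/\ layout tree' half' adr blk out m',
      rs = regs c S x u10 i u12 u13 u14 u15,
      t' + 17 * i <= t + 17 * n + 1,
      (forall k, n <= k -> tree' k = tree k) /\
      (forall k, i + i + 1 < k < n + n -> half' k = k./2) &
      i < n /\ forall k, i < k < n -> node_ok tree' k]).
exists (t + 17 * n + 1); split.
  exists (n - 1), tree, half, u12, u13, u14; split=> //; try lia.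
    by split=> // k; lia.
  by split=> [|k]; lia.
move=> t' rs m' [i [tree' [half' [v12 [v13 [v14]]]]]].
case=> L' -> le_t [leaves hE] [ltin ok]; split; first by lia.
rewrite /=; case: ifPn => lt; last first.
  apply: H L' _ leaves _; first by lia.
    by move=> k ltk; apply: ok; lia.
  by move=> k ltk; apply: hE; lia.
have lt1 : i + i < n + n by lia.
have lt2 : i + i + 1 < n + n by lia.
have L1 := layout_set_half i (layout_set_half i L' lt1) lt2.
rewrite /=; apply: (wp_pull _ _ _ L1); first by lia.
move=> w12 w13 w14 /=.
do 6! eexists; split; [apply: (layout_set_tree _ L1); lia|reflexivity|lia| |].
  split=> k ltk.
    by rewrite -leaves // /update ifN //; lia.
  rewrite /update; case: eqP => [->|E1]; first by lia.
  by case: eqP => [->|E2]; [lia|apply: hE; lia].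
split=> [|k ltk]; first by lia.
rewrite /node_ok /update.
have /negPf -> : k + k != i by lia.
have /negPf -> : k + k + 1 != i by lia.
by case: eqP => [->|/eqP ne] //; apply: ok; lia.
Qed.

Lemma wp_block_neighbours Q t tree half adr blk out m c S x u10 u11 u12 u13 u14 v :
  layout tree half adr blk out m -> v < n -> adr v + inp (adr v) < a0 ->
  (forall j, j < inp (adr v) -> inp (adr v + j + 1) < n) ->
  (forall t' blk' u12 u13 u14 m', t' <= t + 5 * inp (adr v) + 5 ->
     layout tree half adr blk' out m' ->
     (forall i, blk' i =
        if i \in [seq inp (adr v + j + 1) | j <- iota 0 (inp (adr v))] then 1
        else blk i) ->
     Q t' (regs c S x u10 u11 u12 u13 u14 v) m') ->
  wp block_neighbours Q t (regs c S x u10 u11 u12 u13 u14 v) m.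
Proof.
move=> L ltv lta ltn H; rewrite /block_neighbours /= (layout_adr L ltv).
have lta' : adr v < a0 by lia.
rewrite (layout_input L lta').
exists (fun t' rs m' => exists l blk' u14,
  [/\ layout tree half adr blk' out m', l <= inp (adr v),
      rs = regs c S x u10 u11 (adr v + l) (adr v + inp (adr v)) u14 v,
      t' = t + 5 * l + 4 &
      forall i, blk' i =
        if i \in [seq inp (adr v + j + 1) | j <- iota 0 l] then 1 else blk i]).
exists (t + 5 * inp (adr v) + 4); split.
  by exists 0, blk, u14; split=> //; rewrite ?addn0 //; lia.
move=> t' rs m' [l [blk' [v14 [L' lel -> -> bE]]]]; split; first by lia.
rewrite /=; case: ifPn => lt; last first.
  apply: H L' _; first by lia.
  by have <- : l = inp (adr v) by lia.
have ltl : l < inp (adr v) by lia.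
rewrite (layout_input L'); last by lia.
do 3! eexists; split; [exact: (layout_set_blk 1 L' (ltn _ ltl))|exact: ltl| |lia|].
  by rewrite addn1 -addnS.
move=> i; rewrite -[l.+1]addn1 iotaD map_cat mem_cat /= inE add0n /update bE.
by case: (i == _); rewrite ?orbT // orbF.
Qed.

End Loops.

(** * The approximation ratio *)

Section GreedyBound.
Variables (T : finType) (e : rel T) (d : nat).
Hypotheses (e_sym : symmetric e) (e_irr : irreflexive e).

(** With more than [d] such neighbours, [a] as centre and [d + 1] of them as leaves induce a
    claw. *)
Lemma claw_free_card_neighbours (I : {set T}) a :
  claw_free d.+1 e -> independent e I -> #|[set v in I | e a v]| <= d.
Proof.
move=> free indI; rewrite leqNgt; apply/negP=> ltd; apply: free.
set S := [set v in I | e a v] in ltd.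
have SP (i : 'I_d.+1) : enum_val (widen_ord ltd i) \in S by exact: enum_valP.
pose f x := if x is Some i then enum_val (widen_ord ltd i) else a.
have aS (i : 'I_d.+1) : e a (enum_val (widen_ord ltd i)).
  by have := SP i; rewrite inE => /andP[].
exists f; split.
  case=> [i|] [j|] //= fE.
  - by move/enum_val_inj: fE => /(congr1 val) /= ij; congr Some; apply: val_inj.
  - by have := aS i; rewrite fE e_irr.
  - by have := aS j; rewrite -fE e_irr.
case=> [i|] [j|] /=; rewrite /star /=; [|by rewrite e_sym aS|exact: aS|exact: e_irr].
have := SP i; have := SP j; rewrite !inE => /andP[jI _] /andP[iI _].
exact/negbTE/indI.
Qed.

(** The counting uses the gaps [M - b v]: a charged vertex has a gap no larger than the vertex it is
    charged to, so the gaps in [A' :&: D] sum to at most [d] times those in [A]. *)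
Lemma card_independent_le (b : T -> nat) (B M : nat) (A D A' : {set T}) :
  0 < d -> claw_free d.+1 e ->
  (forall v, v \in D -> exists2 a, a \in A & ((a == v) || e a v) && (b a <= b v)) ->
  (forall a, a \in A -> b a <= M) -> (forall v, v \notin D -> M <= b v) ->
  B < budget b A + M -> budgeted_independent e b B A' -> #|A'| <= d * #|A|.
Proof.
move=> d_gt0 free charged leM geM ltB [indA' leB].
pose near v a := (a \in A) && (((a == v) || e a v) && (b a <= b v)).
pose ch v := odflt v [pick a | near v a].
have chP v : v \in D -> near v (ch v).
  move=> vD; rewrite /ch; case: pickP => //= none.
  by have [a aA av] := charged v vD; have := none a; rewrite /near aA av.
(* If [a] is in [A'], independence leaves only [a] itself to be charged to [a], and [0 < d]
   suffices; otherwise every vertex charged to [a] is a neighbour of it. *)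
have cardN a : a \in A -> #|[set v in A' :&: D | ch v == a]| <= d.
  move=> aA; have [aA'|aA'] := boolP (a \in A').
    apply: leq_trans d_gt0; rewrite -(cards1 a); apply/subset_leq_card/subsetP=> v.
    rewrite !inE => /andP[/andP[vA' vD] /eqP va]; move: (chP v vD).
    rewrite va => /andP[_ /andP[/orP[/eqP->//|av] _]].
    by have := indA' _ _ aA' vA'; rewrite av.
  apply: leq_trans (claw_free_card_neighbours a free indA').
  apply/subset_leq_card/subsetP=> v.
  rewrite !inE => /andP[/andP[vA' vD] /eqP va]; rewrite vA' /=; move: (chP v vD).
  rewrite va => /andP[_ /andP[/orP[/eqP av|//] _]].
  by rewrite av vA' in aA'.
have gapE : \sum_(v in A' :&: D) (M - b (ch v)) <= d * \sum_(a in A) (M - b a).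
  rewrite (partition_big ch (mem A)) /=; last first.
    by move=> v; rewrite inE => /andP[_ /chP /andP[]].
  rewrite big_distrr /=; apply: leq_sum => a aA.
  rewrite (eq_bigr (fun=> M - b a)); last by move=> v /andP[_ /eqP->].
  rewrite sum_nat_const leq_mul2r; apply/orP; right.
  apply: leq_trans (cardN a aA); rewrite leq_eqVlt; apply/orP; left; apply/eqP.
  by apply: eq_card => v; rewrite [RHS]inE.
have totA : budget b A + \sum_(a in A) (M - b a) = #|A| * M.
  rewrite -big_split -sum_nat_const /=; apply: eq_bigr => a aA.
  by rewrite subnKC // leM.
have totA' : #|A'| * M <= budget b A' + \sum_(v in A' :&: D) (M - b (ch v)).
  rewrite /budget (big_setID D) /= -(cardsID D A') mulnDl addnAC.
  rewrite -!sum_nat_const -big_split /=.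
  apply: leq_add; apply: leq_sum => v; rewrite !inE.
    move=> /andP[_ /chP /andP[_ /andP[_ ?]]]; lia.
  by move=> /andP[/geM].
rewrite leqNgt; apply/negP=> ltA'.
(* Expanding both sides with [totA] and [totA'] and cancelling the gaps gives
   [M + d * budget b A <= B], against [ltB]. *)
have : (d * #|A|).+1 * M <= #|A'| * M by rewrite leq_mul2r ltA' orbT.
rewrite mulSn -mulnA -totA mulnDr.
have : budget b A <= d * budget b A by rewrite leq_pmull.
lia.
Qed.

End GreedyBound.

(** Double counting of incidences: [w] in [adj v] yields the edge [[set v; w]], injectively in [w]
    as there are no loops, and an edge has at most two elements. *)
Lemma sum_degrees_le (T : finType) (e : rel T) (adj : T -> seq T) :
  irreflexive e -> adjacency_lists e adj ->
  \sum_(v : T) size (adj v) <= 2 * #|edges e|.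
Proof.
move=> e_irr adjP.
have degE v : size (adj v) <= \sum_(A in edges e) (v \in A).
  have [uniq_v mem_v] := adjP v.
  rewrite -(card_uniqP uniq_v) -big_mkcondr sum1_card.
  have inj : {in adj v &, injective (fun w => [set v; w])}.
    move=> w w'; rewrite !mem_v => vw vw' /setP/(_ w); rewrite !inE eqxx orbT.
    by case/esym/orP=> /eqP // wv; rewrite wv e_irr in vw.
  rewrite -(card_in_image inj); apply/subset_leq_card/subsetP=> A.
  case/imageP=> w; rewrite mem_v => vw ->; rewrite unfold_in /= !inE eqxx andbT.
  by apply/existsP; exists v; apply/existsP; exists w; rewrite vw eqxx.
apply: (@leq_trans (\sum_(v : T) \sum_(A in edges e) (v \in A))).
  by apply: leq_sum => v _; exact: degE.
rewrite exchange_big mulnC -sum_nat_const /=; apply: leq_sum => A.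
rewrite inE => /existsP[x /existsP[y /andP[_ /eqP->]]].
rewrite -big_mkcond sum1_card; apply: leq_trans (_ : #|[set x; y]| <= 2) => //.
by rewrite cards2; case: (_ != _).
Qed.

(** * The encoding of the input *)

Lemma nth_flatten_take (U : Type) (x0 : U) (ss : seq (seq U)) i j :
  i < size ss -> j < size (nth [::] ss i) ->
  nth x0 (flatten ss) (sumn (take i (shape ss)) + j) = nth x0 (nth [::] ss i) j.
Proof.
elim: ss i => // s ss IH [|i] /= lti ltj; first by rewrite add0n nth_cat ltj.
by rewrite nth_cat -addnA ltnNge leq_addr /= addKn IH.
Qed.

Section EncodingTheory.
Variables (T : finType) (adj : T -> seq T) (b : T -> nat) (B : nat).

Let lists := [seq size (adj v) :: [seq vertex_num w | w <- adj v] | v <- enum T].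

(** The cell holding the degree of vertex number [i], after a header of [#|T| + 2] cells. At
    [i = #|T|] it is the end of the input. *)
Definition list_address (i : nat) : nat := #|T| + 2 + sumn (take i (shape lists)).

Let inp := nth 0 (encode adj b B).

Lemma vertex_num_inj : injective (@vertex_num T).
Proof. by move=> v w /val_inj /enum_rank_inj. Qed.

Lemma vertex_num_lt v : @vertex_num T v < #|T|.
Proof. exact: ltn_ord. Qed.

Lemma vertex_num_surj i : i < #|T| -> exists v : T, vertex_num v = i.
Proof.
by move=> lti; exists (enum_val (Ordinal lti)); rewrite /vertex_num enum_valK.
Qed.

Lemma nth_enum_vertex_num (v0 v : T) : nth v0 (enum T) (vertex_num v) = v.
Proof. exact: nth_enum_rank. Qed.

Lemma encode_budget v : inp (vertex_num v + 2) = b v.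
Proof.
rewrite /inp /encode !addnS addn0 /= nth_cat size_map -cardE vertex_num_lt.
by rewrite (nth_map v) -?cardE ?vertex_num_lt // nth_enum_vertex_num.
Qed.

Lemma encode_lists i : inp (#|T| + 2 + i) = nth 0 (flatten lists) i.
Proof.
by rewrite /inp /encode !addnS addn0 !addSn /= nth_cat size_map -cardE
  ltnNge leq_addr /= addKn.
Qed.

Lemma size_lists : size lists = #|T|.
Proof. by rewrite size_map -cardE. Qed.

Lemma nth_lists v : nth [::] lists (vertex_num v) =
  size (adj v) :: [seq vertex_num w | w <- adj v].
Proof.
by rewrite (nth_map v) -?cardE ?vertex_num_lt // nth_enum_vertex_num.
Qed.

Lemma encode_degree v : inp (list_address (vertex_num v)) = size (adj v).
Proof.
rewrite /list_address encode_lists -[sumn _]addn0.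
by rewrite nth_flatten_take ?size_lists ?vertex_num_lt // nth_lists.
Qed.

Lemma encode_neighbours v :
  [seq inp (list_address (vertex_num v) + j + 1) | j <- iota 0 (size (adj v))] =
  [seq vertex_num w | w <- adj v].
Proof.
apply: (@eq_from_nth _ 0) => [|j]; rewrite !size_map ?size_iota // => ltj.
rewrite (nth_map 0) ?size_iota // nth_iota // add0n -addnA /list_address -addnA.
rewrite encode_lists nth_flatten_take ?size_lists ?vertex_num_lt // nth_lists addn1 //.
by rewrite /= size_map ltnS.
Qed.

Lemma list_address0 : list_address 0 = #|T| + 2.
Proof. by rewrite /list_address take0 addn0. Qed.

Lemma list_addressS i : i < #|T| ->
  list_address i.+1 = list_address i + inp (list_address i) + 1.
Proof.
move=> /vertex_num_surj [v <-]; rewrite encode_degree /list_address.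
have ltv : vertex_num v < size lists by rewrite size_lists vertex_num_lt.
rewrite (take_nth 0); last by rewrite size_map.
rewrite sumn_rcons (nth_map [::]) // nth_lists /= size_map.
lia.
Qed.

Lemma list_address_end : list_address #|T| = size (encode adj b B).
Proof.
rewrite /list_address take_oversize; last by rewrite size_map size_lists.
by rewrite /encode size_cat /= size_map -cardE size_flatten -/lists; lia.
Qed.

Lemma list_address_lt v :
  list_address (vertex_num v) + size (adj v) < size (encode adj b B).
Proof.
have le_end i : i <= #|T| -> list_address i <= size (encode adj b B).
  rewrite -list_address_end; move: #|T| (@list_addressS) => n addrS.
  elim: n addrS => [|n IH] addrS; first by rewrite leqn0 => /eqP->.
  rewrite leq_eqVlt => /orP[/eqP->//|]; rewrite ltnS => lein.
  by apply: leq_trans (IH _ lein) _ => [j ltj|]; rewrite addrS; lia.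
have := le_end _ (vertex_num_lt v); rewrite list_addressS ?vertex_num_lt //.
by rewrite encode_degree addn1.
Qed.

End EncodingTheory.

(** * Correctness of the program *)

Section Greedy.
Variables (T : finType) (e : rel T) (adj : T -> seq T) (b : T -> nat) (B : nat).
Hypotheses (e_sym : symmetric e) (e_irr : irreflexive e).
Hypothesis adjP : adjacency_lists e adj.

(* [D] is the set of the vertices extracted so far and [l] lists those that were
   selected. *)
Record greedy_state (D : {set T}) (l : seq T) : Prop := GreedyState {
  greedy_uniq : uniq l;
  greedy_sub : {subset l <= D};
  greedy_indep : independent e [set v in l];
  greedy_budget : budget b [set v in l] <= B;
  greedy_charge : forall v, v \in D ->
    exists2 a, a \in l & ((a == v) || e a v) && (b a <= b v);
  greedy_order : forall u w, u \in D -> w \notin D -> b u <= b w }.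

Lemma greedy_state0 : greedy_state set0 [::].
Proof.
split=> // [x y|||]; rewrite ?inE //.
- by rewrite /budget big1 // => v; rewrite inE.
- by move=> v; rewrite inE.
- by move=> u w; rewrite inE.
Qed.

Section Step.
Variables (D : {set T}) (l : seq T) (v : T).
Hypotheses (stD : greedy_state D l) (vD : v \notin D).
Hypothesis v_min : forall w, w \notin D -> b v <= b w.

Lemma greedy_order_step u w : u \in v |: D -> w \notin v |: D -> b u <= b w.
Proof.
rewrite !inE negb_or => /orP[/eqP->|uD] /andP[_ wD]; first exact: v_min.
exact: (greedy_order stD).
Qed.

(** The blocking neighbour was extracted before [v], hence is not more expensive, and [v] can be
    charged to it. *)
Lemma greedy_skip : has (e^~ v) l -> greedy_state (v |: D) l.
Proof.
move=> /hasP[a al av]; split; try by case: stD.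
- by move=> w /(greedy_sub stD) wD; rewrite inE wD orbT.
- move=> w; rewrite inE => /orP[|/(greedy_charge stD)//].
  rewrite inE => /eqP->; exists a => //; rewrite av orbT /=.
  by apply: (greedy_order stD) vD; exact: (greedy_sub stD).
- exact: greedy_order_step.
Qed.

Lemma budget_rcons : budget b [set w in rcons l v] = budget b [set w in l] + b v.
Proof.
rewrite /budget addnC -(big_setU1 _ (_ : v \notin [set w in l])) /=.
  by apply: eq_bigl => w; rewrite !inE mem_rcons inE.
by rewrite inE; apply: contra vD; exact: (greedy_sub stD).
Qed.

Lemma greedy_select : ~~ has (e^~ v) l -> budget b [set w in l] + b v <= B ->
  greedy_state (v |: D) (rcons l v).
Proof.
move=> free leB; have nl a : a \in l -> ~~ e a v by move=> al; exact: (hasPn free).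
split.
- rewrite rcons_uniq (greedy_uniq stD) andbT.
  by apply: contra vD; exact: (greedy_sub stD).
- move=> w; rewrite mem_rcons !inE => /orP[->//|/(greedy_sub stD)->].
  by rewrite orbT.
- move=> x y; rewrite !inE !mem_rcons !inE.
  move=> /orP[/eqP->|xl] /orP[/eqP->|yl]; rewrite ?e_irr //.
  + by rewrite e_sym nl.
  + exact: nl.
  + by apply: (greedy_indep stD); rewrite inE.
- by rewrite budget_rcons.
- move=> w; rewrite !inE => /orP[/eqP->|/(greedy_charge stD)[a al aw]].
    by exists v; rewrite ?mem_rcons ?inE eqxx /=.
  by exists a; rewrite ?mem_rcons ?inE ?al ?orbT.
- exact: greedy_order_step.
Qed.

End Step.

Let n := #|T|.
Let a0 := size (encode adj b B).
Let a1 := a0 + n + n.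
Let a2 := a1 + n + n.
Let a3 := a2 + n.
Let a4 := a3 + n.
Let inp := nth 0 (encode adj b B).
Let pos := list_address adj.
Hypothesis n_gt0 : 0 < n.

Local Notation Rg := (regs n B.+1 a0 a1 a2 a3 a4).
Local Notation Ly := (layout n a0 a1 a2 a3 a4 inp).

(** A bound on the time of the iteration extracting [v]: per level [6] steps down and [12] up, [5]
    per neighbour to be blocked, and a constant. *)
Definition vertex_cost v := 18 * trunc_log 2 n + 60 + 5 * size (adj v).

(** The link between the tables and the abstract greedy state; in [machine_blk] the boolean is
    coerced to [0] or [1]. *)
Record machine_state half (D : {set T}) (l : seq T) (tree adr blk out m : nat -> nat) : Prop := MachineState {
  machine_layout : Ly tree half adr blk out m;
  machine_tree : tree_ok n tree;
  machine_leaf : forall v, tree (n + vertex_num v) = if v \in D then B.+1 else b v;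
  machine_adr : forall v : T, adr (vertex_num v) = pos (vertex_num v);
  machine_blk : forall v : T, blk (vertex_num v) = has (e^~ v) l;
  machine_out : [seq out i | i <- iota 0 (size l)] = [seq vertex_num v | v <- l] }.

Local Opaque pull descend ascend block_neighbours.

Lemma wp_greedy Q t half tree adr blk out m u10 u11 u12 u13 u14 u15 x :
  (forall i, 1 < i < n + n -> half i = i./2) ->
  machine_state half set0 [::] tree adr blk out m ->
  (forall t' D l tree blk out m u10 u11 u12 u13 u14 u15,
     t' <= t + \sum_v vertex_cost v + 4 ->
     greedy_state D l -> machine_state half D l tree adr blk out m ->
     B < budget b [set v in l] + tree 1 ->
     Q t' (Rg (size l) (budget b [set v in l]) (tree 1) u10 u11 u12 u13 u14 u15) m) ->
  wp greedy Q t (Rg 0 0 x u10 u11 u12 u13 u14 u15) m.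
Proof.
move=> halfE M0 H; rewrite /greedy /=.
have lt1 : 1 < n + n by lia.
rewrite (layout_tree (machine_layout M0) lt1).
(* The costs of the vertices not yet extracted serve as a potential: each iteration pays with the
   cost of the vertex it extracts. *)
exists (fun t' rs m => exists D l tree blk out u10 u11 u12 u14 u15,
  [/\ greedy_state D l, machine_state half D l tree adr blk out m,
      t' + \sum_(v in ~: D) vertex_cost v <= t + \sum_v vertex_cost v + 3 &
      rs = Rg (size l) (budget b [set v in l]) (tree 1) u10 u11 u12
             (budget b [set v in l] + tree 1) u14 u15]).
exists (t + \sum_v vertex_cost v + 3); split.
  exists set0, [::], tree, blk, out, u10, u11; do 3! eexists; split=> //.
  - exact: greedy_state0.
  - by rewrite setC0 (eq_bigl xpredT) => [|v]; rewrite ?inE //; lia.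
  - have -> : budget b [set v in [::]] = 0.
      by rewrite /budget big1 // => v; rewrite inE.
    by [].
move=> {M0} t' rs {}m [D [l [{}tree [{}blk [{}out [v10 [v11 [v12 [v14 [v15]]]]]]]]]].
case=> stD M le_t ->; split; first by lia.
rewrite /=; case: ifPn => ltB; last first.
  by apply: H stD M _; [lia | rewrite ltnS -ltnNge in ltB].
apply: (wp_descend n_gt0 erefl erefl erefl erefl _ _ _ (machine_layout M) (machine_tree M)).
move=> t1 i w12 w13 le_t1 lti tree_i /=.
have [v vE] : exists v : T, vertex_num v = i - n by apply: vertex_num_surj; lia.
have iE : i = n + vertex_num v by rewrite vE; lia.
(* The loop test gives [tree 1 <= B], whereas extracted leaves hold [B + 1]. *)
have vD : v \notin D.
  by apply/negP=> vD; move: tree_i; rewrite iE (machine_leaf M) vD; lia.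
have bv : b v = tree 1 by rewrite -tree_i iE (machine_leaf M) (negbTE vD).
have v_min w : w \notin D -> b v <= b w.
  move=> wD; have := machine_leaf M w; rewrite (negbTE wD) bv => <-.
  apply: (tree_root_min (machine_tree M)).
  by have := vertex_num_lt w; rewrite -/n; lia.
have lti2 : i < n + n by lia.
have L1 := layout_set_tree n_gt0 erefl erefl erefl erefl B.+1 (machine_layout M) lti2.
apply: (wp_ascend n_gt0 erefl erefl erefl erefl _ _ _ L1 halfE); first by lia.
  move=> k ltk ne; rewrite /node_ok /update.
  have /negPf -> : k + k != i by lia.
  have /negPf -> : k + k + 1 != i by lia.
  have /negPf -> : k != i by lia.
  by apply: (machine_tree M); lia.
move=> t2 tree' w11 {}w12 {}w13 w14 m' le_t2 L2 ok2 leaves /=.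
rewrite -vE (layout_blk L2) ?vertex_num_lt // (machine_blk M).
have leaf' w : tree' (n + vertex_num w) = if w \in v |: D then B.+1 else b w.
  rewrite leaves ?leq_addr // /update iE eqn_add2l (inj_eq (@vertex_num_inj T)) !inE.
  by case: eqP => //= _; exact: (machine_leaf M).
have costE : \sum_(w in ~: D) vertex_cost w =
    vertex_cost v + \sum_(w in ~: (v |: D)) vertex_cost w.
  rewrite (bigD1 v) ?inE //=; congr (_ + _); apply: eq_bigl => w.
  by rewrite !inE negb_or andbC.
have cvE : vertex_cost v = 18 * trunc_log 2 n + 60 + 5 * size (adj v) by [].
have [blocked|free] := boolP (has (e^~ v) l); rewrite /=.
  rewrite (layout_tree L2) //.
  exists (v |: D), l, tree', blk, out; do 5! eexists; split; last reflexivity.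
  - exact: greedy_skip.
  - by split=> //; case: M.
  - by move: le_t; rewrite costE; lia.
have stD' : greedy_state (v |: D) (rcons l v).
  by apply: greedy_select => //; rewrite bv -ltnS.
(* The result array has room for one more entry: the selected vertices lie in [D], which misses
   [v]. *)
have ltl : size l < n.
  have := max_card (mem (v |: D)); rewrite cardsU1 vD.
  have := subset_leq_card (_ : [set w in l] \subset D).
  rewrite cardsE (card_uniqP (greedy_uniq stD)) => leD.
  have /leD : [set w in l] \subset D.
    by apply/subsetP=> w; rewrite inE; exact: (greedy_sub stD).
  by rewrite /n; lia.
have L3 := layout_set_out n_gt0 erefl erefl erefl erefl (vertex_num v) L2 ltl.
have adrE := machine_adr M v.
have degE : inp (adr (vertex_num v)) = size (adj v) by rewrite adrE; exact: encode_degree.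
have nbrE : [seq inp (adr (vertex_num v) + j + 1) | j <- iota 0 (size (adj v))] =
    [seq vertex_num w | w <- adj v] by rewrite adrE; exact: encode_neighbours.
apply: (wp_block_neighbours n_gt0 erefl erefl erefl erefl _ _ _ L3).
- exact: vertex_num_lt.
- by rewrite degE adrE; exact: list_address_lt.
- move=> j; rewrite degE => ltj.
  have : inp (adr (vertex_num v) + j + 1) \in [seq vertex_num w | w <- adj v].
    by rewrite -nbrE; apply/mapP; exists j; rewrite ?mem_iota.
  by case/mapP=> w _ ->; exact: vertex_num_lt.
move=> t3 blk' x12 x13 x14 m3; rewrite degE nbrE => le_t3 L4 blkE /=.
rewrite (layout_tree L4) // -bv -(budget_rcons stD vD) addn1 -(size_rcons l v).
exists (v |: D), (rcons l v), tree', blk'; do 6! eexists; split; last reflexivity.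
- exact: stD'.
- split=> //; first exact: L4.
  + by case: M.
  + move=> w; rewrite blkE (mem_map (@vertex_num_inj T)) (proj2 (adjP v)).
    by rewrite has_rcons (machine_blk M); case: (e v w).
  + rewrite size_rcons -addn1 iotaD map_cat map_rcons -cats1 /= add0n.
    rewrite /update eqxx -(machine_out M); congr (_ ++ _).
    by apply/eq_in_map=> k; rewrite mem_iota => ltk; rewrite ifN //; lia.
- by move: le_t; rewrite costE; lia.
Qed.

End Greedy.

(* Assembly of the time bound and the approximation guarantee *)
Local Opaque skip_lists fill_leaves build_tree greedy.

Theorem theorem3 (d : nat) (d_gt0 : 0 < d) :
  exists (P : cmd) (c : nat),
    forall (T : finType) (e : rel T) (adj : T -> seq T) (b : T -> nat) (B : nat),
      symmetric e -> irreflexive e -> adjacency_lists e adj ->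
      claw_free d.+1 e ->
      (forall v, 0 < b v) -> 0 < B ->
      exists (t : nat) (s : state) (A : {set T}),
        [/\ exec P (init (encode adj b B)) t s,
            t <= c * maxn 1 (#|T| * trunc_log 2 #|T| + #|edges e|),
            perm_eq (output s) [seq vertex_num v | v <- enum A],
            budgeted_independent e b B A
          & forall A' : {set T}, max_budgeted_independent e b B A' ->
              #|A'| <= d * #|A| ].
Proof.
(* The phases take at most [18 n log n + 94 n + 10 |E|] steps plus a small constant; [200] leaves
   slack. *)
exists mbis_program, 200 => T e adj b B e_sym e_irr adjP free _ _.
set n := #|T|; set inp := encode adj b B.
suff : wp mbis_program (fun t rs m => exists A : {set T},
    [/\ t <= 200 * maxn 1 (n * trunc_log 2 n + #|edges e|),
        perm_eq [seq m (nth 0 rs 0 + i) | i <- iota 0 (nth 0 rs 1)]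
                [seq vertex_num v | v <- enum A],
        budgeted_independent e b B A
      & forall A' : {set T}, max_budgeted_independent e b B A' ->
          #|A'| <= d * #|A| ]) 0 (nseq 16 0) (nth 0 inp).
  move=> W; have [|t [s [rs [m [ex [rE mE] [A [le_t out ind opt]]]]]]] :=
    wp_sound (s := init inp) W.
    by split=> // i; rewrite nth_nseq if_same.
  exists t, s, A; split=> //; rewrite /output !rE.
  by rewrite (eq_map (g := fun i => m (nth 0 rs 0 + i))).
rewrite /mbis_program /= -/n.
case: ifPn => n_gt0; last first.
  have T0 : #|T| = 0 by apply/eqP; rewrite -leqn0 leqNgt.
  exists set0; split.
  - by move: (_ + _) => x; lia.
  - by rewrite enum_set0.
  - split=> [x y|]; first by rewrite inE.
    by rewrite /budget big1 // => v; rewrite inE.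
  - by move=> A' _; rewrite cards0 muln0 -T0 max_card.
rewrite addn1.
have posS v : v < n -> list_address adj v.+1 =
    list_address adj v + nth 0 inp (list_address adj v) + 1 by exact: list_addressS.
apply: (wp_skip_lists _ _ _ (list_address0 adj) posS) => u11 u12 /=.
rewrite (list_address_end adj b B) -/inp.
set a0 := size inp.
(* Memory beyond the input is zero, so the blocked flags need no initialisation. *)
have L0 : layout n a0 (a0 + n + n) (a0 + n + n + n + n) (a0 + n + n + n + n + n)
    (a0 + n + n + n + n + n + n) (nth 0 inp)
    (fun=> 0) (fun=> 0) (fun=> 0) (fun=> 0) (fun=> 0) (nth 0 inp).
  by split=> // i _; rewrite nth_default // -?addnA leq_addr.
apply: (wp_fill_leaves n_gt0 erefl erefl erefl erefl _ _ _ _ L0 (list_address0 adj)).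
- move=> i lti; split; last exact: posS.
  have [v <-] := vertex_num_surj lti.
  exact: leq_ltn_trans (leq_addr _ _) (list_address_lt adj b B v).
- by rewrite /a0 /inp -(list_address_end adj b B) leq_addr.
move=> tree1 adr v10 {}v11 v12 v13 m1 L1 leaf1.
apply: (wp_build_tree n_gt0 erefl erefl erefl erefl _ _ _ _ L1).
move=> t2 tree2 half w11 w12 w13 w14 m2 le_t2 L2 ok2 leaf2 halfE.
have numlt (v : T) : vertex_num v < n by exact: vertex_num_lt.
have M2 : machine_state e adj b B half set0 [::] tree2 adr (fun=> 0) (fun=> 0) m2.
  split=> // v.
  - rewrite leaf2 ?leq_addr // (proj1 (leaf1 _ (numlt v))) inE.
    exact: encode_budget.
  - by rewrite (proj2 (leaf1 _ (numlt v))).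
apply: (wp_greedy e_sym e_irr adjP n_gt0 _ _ _ _ _ _ _ halfE M2).
move=> t3 D l tree blk out m3 x10 x11 x12 x13 x14 x15 le_t3 stD M ltB.
exists [set v in l].
have size_l : size l <= n.
  by rewrite -(card_uniqP (greedy_uniq stD)) max_card.
split.
- have := sum_degrees_le e_irr adjP.
  move: le_t2 le_t3; rewrite -/n /vertex_cost big_split /= sum_nat_const -big_distrr /=.
  move: (\sum_v _) => degs; rewrite cardT -cardE -/n mulnDr mulnCA.
  (* This absorbs the linear terms; the [1] is needed at [n = 1], where the logarithm vanishes. *)
  have : n <= maxn 1 (n * trunc_log 2 n).
    case: (ltnP 1 n) => [n_gt1|]; last by rewrite leq_max => ->.
    by rewrite leq_max leq_pmulr ?orbT // trunc_log_gt0.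
  move: (n * trunc_log 2 n) #|edges e| => nlg E.
  lia.
- apply: (@perm_trans _ [seq vertex_num v | v <- l]).
    rewrite -(machine_out M) /=.
    suff /eq_in_map-> : {in iota 0 (size l), forall i,
        m3 (a0 + n + n + n + n + n + n + i) = out i} by [].
    move=> i; rewrite mem_iota => /andP[_ lti].
    exact: (layout_out (machine_layout M)) (leq_trans lti size_l).
  apply: perm_map; apply: uniq_perm; rewrite ?enum_uniq ?(greedy_uniq stD) //.
  by move=> v; rewrite mem_enum inE.
- by split; [exact: (greedy_indep stD)|exact: (greedy_budget stD)].
move=> A' [bA' _].
apply: (card_independent_le e_sym e_irr (b := b) (B := B) (M := tree 1) (D := D)) => //.
- by move=> v /(greedy_charge stD)[a al av]; exists a; rewrite ?inE.
(* The root key is the key of some leaf. If that leaf was extracted, the key is [B + 1], above [b a]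
   since the selection respects the budget; otherwise the extraction order gives the bound. *)
- move=> a; rewrite inE => al.
  have [k ltk <-] := tree_root_attained n_gt0 (machine_tree M).
  have [w <-] := vertex_num_surj ltk.
  rewrite (machine_leaf M); case: ifPn => wD; last first.
    exact: (greedy_order stD) (greedy_sub stD al) wD.
  apply: leqW; apply: leq_trans (greedy_budget stD).
  by rewrite /budget (bigD1 a) ?inE // leq_addr.
- move=> v vD; have := machine_leaf M v; rewrite (negbTE vD) => <-.
  by apply: (tree_root_min (machine_tree M)); have := numlt v; lia.
Qed.
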